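(* Let $\mathcal{X}$ be a Polish space with a complete consistent metric $d$, let $\Theta$ be a Polish space, let $\mathcal{P}\colon\Theta\to\mathcal{M}(\mathcal{X})$ be measurable with image $\mathcal{A}_0:=\mathcal{P}(\Theta)$, and assume $\mathcal{P}$ is positive: $\mu(B_\delta(x))>0$ for all $\mu\in\mathcal{A}_0$, $x\in\mathcal{X}$, $\delta>0$. Let $\Pi_\Theta\subseteq\mathcal{M}(\Theta)$, $\Pi_0:=\mathcal{P}\Pi_\Theta\subseteq\mathcal{M}(\mathcal{A}_0)$, and let $\Phi_0\colon\mathcal{M}(\mathcal{X})\to\mathbb{R}$ be measurable and semibounded. Let $\delta>0$ and $0<\alpha<1$ satisfy $\mathcal{P}_\infty(\delta)<\alpha$. Then, for all integers $n\ge1$ and all $(x_1,\dots,x_n)\in\mathcal{X}^n$, \[\mathcal{U}(\Pi_\alpha\,|\,B^n_\delta)\ge\Pi_0^\infty(\Phi_0),\] and similarly $\mathcal{L}(\Pi_\alpha\,|\,B^n_\delta)\le\inf_{\pi\in\Pi_0}\sup\{r\in\mathbb{R}:\pi[\Phi_0<r]=0\}$.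
   Context: $\mathcal{M}(\mathcal{X})$ is the set of Borel probability measures on $\mathcal{X}$ with the weak topology, metrized by the Prokhorov metric $d_{\mathcal{M}}(\mu_1,\mu_2):=\inf\{\varepsilon>0:\mu_1(A)\le\mu_2(A^\varepsilon)+\varepsilon\ \forall A\in\mathcal{B}(\mathcal{X})\}$, $A^\varepsilon=\{x:d(x,x')<\varepsilon\text{ for some }x'\in A\}$. $B_\delta(x)$ is the open $d$-ball of radius $\delta$ about $x$; $B_\alpha(\mu)$ is the open Prokhorov ball. $\mathcal{P}\Pi_\Theta$ is the set of pushforwards. $\mathcal{P}_\infty(\delta):=\sup_{x\in\mathcal{X}}\sup_{\theta\in\Theta}\mathcal{P}(\theta)[B_\delta(x)]$. Let $\mathcal{A}_\alpha:=\bigcup_{\mu\in\mathcal{A}_0}B_\alpha(\mu)$, $\mathcal{A}:=\{(\mu_1,\mu_2)\in\mathcal{M}(\mathcal{X})^2:\mu_1\in\mathcal{A}_0,\ d_{\mathcal{M}}(\mu_1,\mu_2)<\alpha\}$, $P_0(\mu_1,\mu_2)=\mu_1$, $P_\alpha(\mu_1,\mu_2)=\mu_2$, and $\Pi_\alpha:=P_\alpha P_0^{-1}\Pi_0=\{P_\alpha\pi:\pi\in\mathcal{M}(\mathcal{A}),\ P_0\pi\in\Pi_0\}\subseteq\mathcal{M}(\mathcal{A}_\alpha)$. $B^n_\delta:=\prod_{i=1}^nB_\delta(x_i)$; the data distribution under $\mu$ is $\mu^n$. For $\pi\in\mathcal{M}(\mathcal{A}_\alpha)$ with $\mathbb{E}_{\mu\sim\pi}[\mu^n(B^n_\delta)]>0$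 the posterior value is $\mathbb{E}_{\mu\sim\pi}[\Phi_0(\mu)\mu^n(B^n_\delta)]/\mathbb{E}_{\mu\sim\pi}[\mu^n(B^n_\delta)]$; $\mathcal{U}(\Pi_\alpha|B^n_\delta)$ (resp. $\mathcal{L}$) is its supremum (resp. infimum) over such $\pi\in\Pi_\alpha$ ($\sup\varnothing=-\infty$, $\inf\varnothing=+\infty$). $\Pi_0^\infty(\Phi_0):=\sup_{\pi\in\Pi_0}\inf\{r\in\mathbb{R}:\pi[\Phi_0>r]=0\}$. *)

(* Defs.v *)
From HB Require Import structures.
From mathcomp Require Import all_boot all_order all_algebra.
From mathcomp Require Import all_classical all_reals all_analysis.
Unset Printing Implicit Defensive.
Import Order.TTheory GRing.Theory Num.Theory.
Local Open Scope classical_set_scope.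
Local Open Scope ring_scope.

Definition is_metric {R : realType} {T : Type} (d : T -> T -> R) : Prop :=
  (forall x y, 0 <= d x y) /\ (forall x y, d x y = 0 <-> x = y) /\
  (forall x y, d x y = d y x) /\ (forall x y z, d x z <= d x y + d y z).

Definition metric_complete {R : realType} {T : Type} (d : T -> T -> R) : Prop :=
  forall u : nat -> T,
    (forall e, 0 < e -> exists N, forall m n, (N <= m)%N -> (N <= n)%N -> d (u m) (u n) < e) ->
    exists l, forall e, 0 < e -> exists N, forall n, (N <= n)%N -> d (u n) l < e.

Definition metric_separable {R : realType} {T : Type} (d : T -> T -> R) : Prop :=
  exists D : set T, countable D /\ forall x e, 0 < e -> exists y, D y /\ d x y < e.

(** A Polish space, presented with a complete consistent metric [d]
    (the topology is the one induced by [d]). *)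
Definition polish_metric {R : realType} {T : Type} (d : T -> T -> R) : Prop :=
  [/\ is_metric d, metric_complete d & metric_separable d].

Definition mball {R : realType} {T : Type} (d : T -> T -> R) (x : T) (e : R) : set T :=
  [set y | d x y < e].

Definition mopen {R : realType} {T : Type} (d : T -> T -> R) : set (set T) :=
  [set O | forall x, O x -> exists e, 0 < e /\ mball d x e `<=` O].

Definition enbhd {R : realType} {T : Type} (d : T -> T -> R) (A : set T) (e : R) : set T :=
  [set x | exists x', A x' /\ d x x' < e].

Definition borel_of {R : realType} {T : pointedType} (d : T -> T -> R) :=
  g_sigma_algebraType (mopen d).

Definition prokhorov {R : realType} {T : pointedType} (d : T -> T -> R)
    (mu1 mu2 : probability (borel_of d) R) : R :=
  inf [set e : R | 0 < e /\
        forall A : set (borel_of d), measurable A ->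
          (mu1 A <= mu2 (enbhd d A e) + e%:E)%E].

(** [M(X)] : Borel probability measures on [X] with the Borel
    sigma-algebra of the weak topology, metrized by the Prokhorov metric. *)
Definition MX {R : realType} {T : pointedType} (d : T -> T -> R) :=
  g_sigma_algebraType (mopen (prokhorov d)).

Definition is_pushforward {d1 d2} {T1 : measurableType d1} {T2 : measurableType d2}
    {R : realType} (nu : set T2 -> \bar R) (mu : set T1 -> \bar R) (f : T1 -> T2) : Prop :=
  forall B, measurable B -> nu B = mu (f @^-1` B).

(** [mu] is (the extension to the ambient space of) a measure on the subspace
    [S] with its trace sigma-algebra: every measurable set disjoint from [S]
    is [mu]-null. *)
Definition concentrated {d} {T : measurableType d} {R : realType}
    (mu : set T -> \bar R) (S : set T) : Prop :=
  forall B, measurable B -> B `&` S = set0 -> mu B = 0%E.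

Definition Pi0 {R : realType} {X Th : pointedType} (d : X -> X -> R) (dT : Th -> Th -> R)
    (P : Th -> probability (borel_of d) R) (PiTh : set (probability (borel_of dT) R))
    : set (probability (MX d) R) :=
  [set nu | exists pt, PiTh pt /\ is_pushforward nu pt (P : borel_of dT -> MX d)].

Definition calA {R : realType} {X Th : pointedType} (d : X -> X -> R)
    (P : Th -> probability (borel_of d) R) (alpha : R) : set (MX d * MX d) :=
  [set p | (exists th, P th = p.1) /\ prokhorov d p.1 p.2 < alpha].

Definition Pialpha {R : realType} {X Th : pointedType} (d : X -> X -> R) (dT : Th -> Th -> R)
    (P : Th -> probability (borel_of d) R) (PiTh : set (probability (borel_of dT) R))
    (alpha : R) : set (probability (MX d) R) :=
  [set nu | exists pi : probability (MX d * MX d)%type R,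
     [/\ concentrated pi (calA d P alpha),
         (exists nu0, Pi0 d dT P PiTh nu0 /\ is_pushforward nu0 pi fst)
       & is_pushforward nu pi snd]].

(** [mu^n(B^n_delta) = prod_i mu(B_delta(x_i))] *)
Definition likelihood {R : realType} {X : pointedType} (d : X -> X -> R) {n : nat}
    (xs : 'I_n -> X) (delta : R) (mu : MX d) : R :=
  \prod_(i < n) fine ((mu : probability (borel_of d) R) (mball d (xs i) delta)).

Definition post_den {R : realType} {X : pointedType} (d : X -> X -> R) {n : nat}
    (xs : 'I_n -> X) (delta : R) (pi : probability (MX d) R) : \bar R :=
  (\int[pi]_mu (likelihood d xs delta mu)%:E)%E.

Definition post_num {R : realType} {X : pointedType} (d : X -> X -> R) {n : nat}
    (xs : 'I_n -> X) (delta : R) (Phi0 : MX d -> R) (pi : probability (MX d) R) : \bar R :=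
  (\int[pi]_mu (Phi0 mu * likelihood d xs delta mu)%:E)%E.

Definition post_val {R : realType} {X : pointedType} (d : X -> X -> R) {n : nat}
    (xs : 'I_n -> X) (delta : R) (Phi0 : MX d -> R) (pi : probability (MX d) R) : \bar R :=
  (post_num d xs delta Phi0 pi * ((fine (post_den d xs delta pi))^-1)%:E)%E.

(** [U(Pi | B^n_delta)] and [L(Pi | B^n_delta)] (sup of empty = -oo, inf of empty = +oo) *)
Definition post_U {R : realType} {X : pointedType} (d : X -> X -> R) {n : nat}
    (xs : 'I_n -> X) (delta : R) (Phi0 : MX d -> R) (Pi : set (probability (MX d) R)) : \bar R :=
  ereal_sup [set post_val d xs delta Phi0 pi |
             pi in [set pi | Pi pi /\ (0 < post_den d xs delta pi)%E]].

Definition post_L {R : realType} {X : pointedType} (d : X -> X -> R) {n : nat}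
    (xs : 'I_n -> X) (delta : R) (Phi0 : MX d -> R) (Pi : set (probability (MX d) R)) : \bar R :=
  ereal_inf [set post_val d xs delta Phi0 pi |
             pi in [set pi | Pi pi /\ (0 < post_den d xs delta pi)%E]].

Definition ess_sup_over {R : realType} {X : pointedType} (d : X -> X -> R)
    (Pi : set (probability (MX d) R)) (Phi0 : MX d -> R) : \bar R :=
  ereal_sup [set ereal_inf [set r%:E | r in [set r : R | pi [set mu | r < Phi0 mu] = 0%E]]
            | pi in Pi].

Definition ess_inf_over {R : realType} {X : pointedType} (d : X -> X -> R)
    (Pi : set (probability (MX d) R)) (Phi0 : MX d -> R) : \bar R :=
  ereal_inf [set ereal_sup [set r%:E | r in [set r : R | pi [set mu | Phi0 mu < r] = 0%E]]
            | pi in Pi].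

Definition P_infty {R : realType} {X Th : pointedType} (d : X -> X -> R)
    (P : Th -> probability (borel_of d) R) (delta : R) : \bar R :=
  ereal_sup [set z | exists x th, z = P th (mball d x delta)].

Definition semibounded {T : Type} {R : realType} (f : T -> R) : Prop :=
  (exists c, forall t, f t <= c) \/ (exists c, forall t, c <= f t).

(* Main.v *)
Require Import Defs.
From HB Require Import structures.
From mathcomp Require Import all_boot all_order all_algebra.
From mathcomp Require Import all_classical all_reals all_analysis.
From mathcomp Require Import measurable_realfun lra.
Import Order.TTheory GRing.Theory Num.Theory.
Local Open Scope classical_set_scope.
Local Open Scope ring_scope.

(** Let [B] be the first data ball and [z] a point outside [B].  Moving the mass
    of [mu] in [B] to [z] gives a measure that does not charge [B]; for [mu] in
    the model it lies at Prokhorov distance at most [mu B < alpha] from [mu].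
    Fix a prior [pi] and [r] with [pi (Phi0 > r) > 0], and perturb in this way
    exactly the measures with [Phi0 <= r].  These get likelihood [0], hence the
    posterior lives on [Phi0 > r] and its value is at least [r].

    The perturbation has to be Borel for the Prokhorov topology.  It is
    continuous in [mu] together with the number [mu B], and [mu |-> mu B] is lower
    semicontinuous because [B] is open. *)

(** * Image measures and comparison of integrals *)

Section pushforward_probability.
Context {d1 d2 : measure_display} {T1 : measurableType d1}
  {T2 : measurableType d2} {R : realType}.

Definition pushprob {f : T1 -> T2} (mf : measurable_fun setT f)
    (mu : probability T1 R) : probability T2 R :=
  distribution mu
    (HB.pack_for {mfun T1 >-> T2} f (isMeasurableFun.Build _ _ _ _ f mf)).

Lemma pushprobE (f : T1 -> T2) (mf : measurable_fun setT f)
    (mu : probability T1 R) : pushprob mf mu = pushforward mu f :> (set T2 -> \bar R).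
Proof. by []. Qed.

(** The integral is the difference of those of the positive and negative parts, and the nonnegative
    change of variables applies to each; infinite values are allowed. *)
Lemma measurable_integral_pushforward (f : T1 -> T2)
    (mf : measurable_fun setT f) (mu : probability T1 R) (h : T2 -> \bar R) :
  measurable_fun setT h ->
  (\int[pushforward mu f]_y h y = \int[mu]_x h (f x))%E.
Proof.
move=> mh; rewrite integralE [RHS]integralE.
rewrite !(ge0_integral_pushforward mf)//.
- by rewrite preimage_setT -!funepos_comp -!funeneg_comp.
- exact: measurable_funeneg.
- exact: measurable_funepos.
Qed.

Lemma measurable_le_integral (mu : probability T1 R) (f g : T1 -> \bar R) :
  measurable_fun setT f -> measurable_fun setT g ->
  (forall x, f x <= g x)%E -> (\int[mu]_x f x <= \int[mu]_x g x)%E.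
Proof.
move=> mf mg fg; rewrite integralE [leRHS]integralE.
apply: leeB; apply: ge0_le_integral => //; try exact: measurable_funepos;
  try exact: measurable_funeneg.
- move=> x _; rewrite !funeposE; have := fg x => h.
  by rewrite ge_max !le_max h lexx/= orbT.
- move=> x _; rewrite !funenegE; have := fg x => h.
  by rewrite ge_max !le_max leeN2 h lexx/= orbT.
Qed.

End pushforward_probability.

(** * Real-valued measure of sets, suited to linear arithmetic *)

Section real_mass.
Context {dd : measure_display} {T : measurableType dd} {R : realType}.
Implicit Types (mu : probability T R) (A B : set T).

Definition mass mu A : R := fine (mu A).

Lemma massK mu A : measurable A -> (mass mu A)%:E = mu A.
Proof. by move=> mA; rewrite /mass fineK// fin_num_measure. Qed.

Lemma le_mass mu A B : measurable A -> measurable B -> A `<=` B ->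
  mass mu A <= mass mu B.
Proof. by move=> mA mB AB; rewrite -lee_fin !massK// le_measure// inE. Qed.

Lemma mass_ge0 mu A : 0 <= mass mu A.
Proof. exact/fine_ge0. Qed.

Lemma mass_le1 mu A : measurable A -> mass mu A <= 1.
Proof. by move=> mA; rewrite -lee_fin massK// probability_le1. Qed.

Lemma massC mu A : measurable A -> mass mu (~` A) = 1 - mass mu A.
Proof.
move=> mA; apply: EFin_inj.
by rewrite EFinB massK ?probability_setC ?massK//; exact: measurableC.
Qed.

Lemma mass_le_setI_setC mu A B : measurable A -> measurable B ->
  mass mu A <= mass mu (A `&` B) + mass mu (~` B).
Proof.
move=> mA mB; have mC : measurable (~` B) by exact: measurableC.
rewrite -lee_fin EFinD !massK//; last exact: measurableI.
apply: le_trans (measureU2 _ _ _) => //; last exact: measurableI.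
apply: le_measure; rewrite ?inE//.
  by apply: measurableU => //; exact: measurableI.
by move=> x Ax; have [Bx|nBx] := pselect (B x); [left|right].
Qed.

Lemma massU mu A B : measurable A -> measurable B -> A `&` B = set0 ->
  mass mu (A `|` B) = mass mu A + mass mu B.
Proof.
move=> mA mB AB; apply: EFin_inj.
by rewrite EFinD !massK ?measureU//; exact: measurableU.
Qed.

End real_mass.

(** * Open sets and enlargements in a metric space *)

Section metric.
Context {R : realType} {T : pointedType} (d : T -> T -> R).
Hypothesis dM : is_metric d.

Lemma mopen_measurable (O : set T) : mopen d O ->
  measurable (O : set (borel_of d)).
Proof. exact: sub_sigma_algebra. Qed.

Lemma mball_mopen x e : mopen d (mball d x e).
Proof.
case: dM => _ [_] [_ dtri] y /= xy; exists (e - d x y); split.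
  by rewrite subr_gt0.
move=> z /= yz; rewrite /mball/=; have := dtri x y z.
rewrite /mball/= in xy yz; lra.
Qed.

Lemma enbhd_mopen A e : mopen d (enbhd d A e).
Proof.
case: dM => _ [_] [dsym dtri] y /= [a [Aa ya]]; exists (e - d y a); split.
  by rewrite subr_gt0.
move=> z; rewrite /mball/= => yz; exists a; split=> //.
by have := dtri z y a; rewrite (dsym z y); lra.
Qed.

Lemma mball_measurable x e : measurable (mball d x e : set (borel_of d)).
Proof. by apply: mopen_measurable; exact: mball_mopen. Qed.

Lemma enbhd_measurable A e : measurable (enbhd d A e : set (borel_of d)).
Proof. by apply: mopen_measurable; exact: enbhd_mopen. Qed.

Lemma enbhd_sub A e : 0 < e -> A `<=` enbhd d A e.
Proof.
case: dM => _ [d0 _] e0 x Ax; exists x; split=> //.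
by rewrite (proj2 (d0 x x)).
Qed.

Lemma enbhd_le A B e f : A `<=` B -> e <= f -> enbhd d A e `<=` enbhd d B f.
Proof.
by move=> AB ef x [y [Ay xy]]; exists y; split; [exact: AB|exact: lt_le_trans ef].
Qed.

Lemma enbhd_add A e f : enbhd d (enbhd d A e) f `<=` enbhd d A (e + f).
Proof.
case: dM => _ [_] [_ dtri] x [y [[a [Aa ya]] xy]]; exists a; split=> //.
by have := dtri x y a; lra.
Qed.

(** A point off the closed set [F] has a ball missing [F], so it leaves the enlargement once
    [1/(k+1)] is below the radius of that ball. *)
Lemma bigcap_enbhd (F : set T) : mopen d (~` F) ->
  \bigcap_k enbhd d F k.+1%:R^-1 = F.
Proof.
move=> oF; apply/seteqP; split=> [x Fx|x Fx k _]; last first.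
  by apply: enbhd_sub => //; rewrite invr_gt0 ltr0n.
apply: contrapT => /oF [e [e0 eF]].
have [k _ /(_ k (leqnn k)) ke] := near_infty_natSinv_lt (PosNum e0).
have [y [Fy xy]] := Fx k I.
by apply: (eF y) => //; rewrite /mball/=; exact: lt_trans xy ke.
Qed.

(** Continuity from above along the enlargements of radius [1/(k+1)], which decrease to the closed
    set [F]. *)
Lemma mass_enbhd_lt (mu : probability (borel_of d) R) (F : set T) (t : R) :
  mopen d (~` F) -> mass mu F < t ->
  exists2 e, 0 < e & mass mu (enbhd d F e) < t.
Proof.
move=> oF mut.
have mF : measurable (F : set (borel_of d)).
  by rewrite -(setCK F); apply: measurableC; exact: mopen_measurable.
pose G (k : nat) : set (borel_of d) := enbhd d F k.+1%:R^-1.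
have mG k : measurable (G k) by exact: enbhd_measurable.
have : (mu \o G) k @[k --> \oo] --> mu (\bigcap_k G k).
  apply: nonincreasing_cvg_mu => //.
  - by rewrite ltey_eq fin_num_measure.
  - by rewrite /G bigcap_enbhd.
  - move=> m n mn; apply/subsetPset; apply: enbhd_le => //.
    by rewrite lef_pV2 ?posrE// ler_nat.
rewrite /G bigcap_enbhd// -massK// => /fine_cvgP[_ /cvgr_lt /(_ _ mut)].
move=> [k _ /(_ k (leqnn k)) kt].
by exists k.+1%:R^-1 => //; rewrite invr_gt0.
Qed.

End metric.

(** * The Prokhorov metric and its Borel sets *)

Section prokhorov.
Context {R : realType} {T : pointedType} (d : T -> T -> R).
Hypothesis dM : is_metric d.
Local Notation prob := (probability (borel_of d) R).
Implicit Types (mu nu : prob).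

(** The inequality for an admissible radius, in real numbers; positivity of [e] is kept as a
    separate condition. *)
Definition prokhorov_close mu nu (e : R) := forall A : set (borel_of d),
  measurable A -> mass mu A <= mass nu (enbhd d A e) + e.

Lemma prokhorov_closeE mu nu e : prokhorov_close mu nu e <->
  forall A : set (borel_of d), measurable A ->
    (mu A <= nu (enbhd d A e) + e%:E)%E.
Proof.
by split=> h A mA; have := h A mA; have mE := enbhd_measurable d dM A e;
  rewrite -!massK// -EFinD lee_fin.
Qed.

(** Apply the hypothesis to the complement of [A^e]: the [e]-enlargement of that complement misses
    [A], and taking complements of both masses reverses the roles. *)
Lemma prokhorov_close_sym mu nu e :
  prokhorov_close mu nu e -> prokhorov_close nu mu e.
Proof.
move=> h A mA; have mE := enbhd_measurable d dM A e.
have mC : measurable (~` enbhd d A e : set (borel_of d)) by exact: measurableC.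
have := h _ mC; rewrite massC//.
have : mass nu (enbhd d (~` enbhd d A e) e) <= mass nu (~` A).
  apply: le_mass => //; [exact: enbhd_measurable|exact: measurableC|].
  case: dM => _ [_] [dsym _] x [y [ny xy]] Ax; apply: ny; exists x.
  by rewrite dsym.
rewrite massC//; lra.
Qed.

Lemma prokhorov_close_le mu nu e f : e <= f ->
  prokhorov_close mu nu e -> prokhorov_close mu nu f.
Proof.
move=> ef h A mA; have := h A mA.
have : mass nu (enbhd d A e) <= mass nu (enbhd d A f).
  by apply: le_mass; [exact: enbhd_measurable..|exact: enbhd_le].
lra.
Qed.

Lemma prokhorov_close_trans la mu nu e f : prokhorov_close la mu e ->
  prokhorov_close mu nu f -> prokhorov_close la nu (e + f).
Proof.
move=> h1 h2 A mA; have := h1 A mA.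
have := h2 _ (enbhd_measurable d dM A e).
have : mass nu (enbhd d (enbhd d A e) f) <= mass nu (enbhd d A (e + f)).
  by apply: le_mass; [exact: enbhd_measurable..|exact: enbhd_add].
lra.
Qed.

Lemma prokhorov_close_refl mu e : 0 < e -> prokhorov_close mu mu e.
Proof.
move=> e0 A mA.
have : mass mu A <= mass mu (enbhd d A e).
  by apply: le_mass => //; [exact: enbhd_measurable|exact: enbhd_sub].
lra.
Qed.

Lemma prokhorov_le mu nu e : 0 < e -> prokhorov_close mu nu e ->
  prokhorov d mu nu <= e.
Proof.
move=> e0 h; apply: ge_inf; first by exists 0 => x /= [] /ltW.
by split=> //; exact/prokhorov_closeE.
Qed.

(** The infimum is over a nonempty set, as [1] is always admissible, and an admissible radius
    remains so when increased. *)
Lemma prokhorov_lt_close mu nu e : prokhorov d mu nu < e ->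
  prokhorov_close mu nu e.
Proof.
move=> /inf_lt[|f [f0 /prokhorov_closeE h] fe].
  exists 1; split; first exact: ltr01.
  apply/prokhorov_closeE => A mA.
  by have := mass_le1 mu A mA; have := mass_ge0 nu (enbhd d A 1); lra.
exact: prokhorov_close_le (ltW fe) h.
Qed.

Lemma prokhorov_lt mu nu e f : 0 < e -> e < f -> prokhorov_close mu nu e ->
  prokhorov d mu nu < f.
Proof. by move=> e0 ef h; exact: le_lt_trans (prokhorov_le _ _ _ e0 h) ef. Qed.

Lemma prokhorov_refl_lt mu e : 0 < e -> prokhorov d mu mu < e.
Proof.
move=> e0; apply: (prokhorov_lt _ _ (e / 2)); try lra.
by apply: prokhorov_close_refl; lra.
Qed.

Lemma prokhorov_ge0 mu nu : 0 <= prokhorov d mu nu.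
Proof.
apply: lb_le_inf => [|e /= [] /ltW//].
exists 1; split; first exact: ltr01.
apply/prokhorov_closeE => A mA.
by have := mass_le1 mu A mA; have := mass_ge0 nu (enbhd d A 1); lra.
Qed.

Lemma prokhorov_ball_mopen mu e : mopen (prokhorov d) (mball (prokhorov d) mu e).
Proof.
move=> nu; rewrite /mball/= => mn.
have p0 := prokhorov_ge0 mu nu.
exists ((e - prokhorov d mu nu) / 2); split; first lra.
move=> la; rewrite /mball/= => nl.
set p := prokhorov d mu nu in mn p0 nl *.
(* [prokhorov_lt_close] works only strictly above the distance [p], hence the extra [(e - p) / 4];
   the sum still stays below [e]. *)
apply: (prokhorov_lt _ _ ((p + (e - p) / 4) + (e - p) / 2)); try lra.
apply: prokhorov_close_trans (prokhorov_lt_close _ _ _ nl).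
by apply: prokhorov_lt_close; rewrite -/p; lra.
Qed.

Lemma mopen_MX_measurable (O : set (MX d)) : mopen (prokhorov d) O -> measurable O.
Proof. exact: sub_sigma_algebra. Qed.

(** Upper semicontinuity: a mass of [F] below [x] stays below [x] under small Prokhorov
    perturbations, so the preimages of the rays below [x] are open. *)
Lemma measurable_mass_closed (F : set T) : mopen d (~` F) ->
  measurable_fun setT ((fun mu => mass mu F) : MX d -> R).
Proof.
move=> oF.
have mF : measurable (F : set (borel_of d)).
  by rewrite -(setCK F); apply: measurableC; exact: mopen_measurable.
apply: (measurability _ (RGenInftyO.measurableE R)).
move=> _ [_ [x ->] <-]; rewrite setTI; apply: mopen_MX_measurable.
move=> mu /=; rewrite in_itv/= => mux.
have [e e0 ex] := mass_enbhd_lt d dM mu F x oF mux.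
(* [f] keeps the enlargement inside the one of radius [e] and costs at most half of the remaining
   gap. *)
pose f := Num.min e ((x - mass mu (enbhd d F e)) / 2).
have f0 : 0 < f by rewrite lt_min e0/=; lra.
exists f; split=> // nu; rewrite /mball/= in_itv/= => mn.
have := prokhorov_close_sym _ _ _ (prokhorov_lt_close _ _ _ mn) F mF.
have : mass mu (enbhd d F f) <= mass mu (enbhd d F e).
  apply: le_mass; [exact: enbhd_measurable..|apply: enbhd_le => //].
  by rewrite /f ge_min lexx.
have : f <= (x - mass mu (enbhd d F e)) / 2 by rewrite /f ge_min lexx orbT.
lra.
Qed.

(* [S] is only assumed continuous once the Borel statistic [c] is controlled:
   the preimage of an open set is then a countable union, over rational windows
   for [c], of traces of open sets. *)
Lemma measurable_continuous_modulo (S : MX d -> MX d) (c : MX d -> R) :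
  measurable_fun setT c ->
  (forall mu (e : R), 0 < e -> exists2 t : R, 0 < t & forall nu,
     prokhorov d mu nu < t -> `|c nu - c mu| < t ->
     prokhorov d (S mu) (S nu) < e) ->
  measurable_fun setT S.
Proof.
move=> mc cont.
apply: (@measurability _ _ (MX d) (MX d) setT S (mopen (prokhorov d)) erefl).
move=> _ [G oG <-]; rewrite setTI.
pose s (k : nat) : R := k.+1%:R^-1.
pose C (q : rat) k : set (MX d) :=
  c @^-1` `]ratr q - s k, ratr q + s k[.
(* [V q k] is a union of balls of radius [s k], hence open; [S] sends the part of each such ball in
   the window [C q k] into [G]. *)
pose V (q : rat) k : set (MX d) := [set nu | exists2 mu : MX d,
  prokhorov d mu nu < s k &
  forall la, prokhorov d mu la < s k -> C q k la -> G (S la)].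
have -> : S @^-1` G = \bigcup_k \bigcup_q (C q k `&` V q k).
  apply/seteqP; split=> [mu /= /oG [e [e0 eG]]|nu]; last first.
    by case=> k _ [q _ [Cnu [mu mn H]]]; exact: H.
  have [t t0 tS] := cont mu e e0.
  (* Values of [c] in one window differ by less than [2 * s k], so [s k < t / 2] makes them differ
     by less than [t]. *)
  have t2 : 0 < t / 2 by lra.
  have [k _ /(_ k (leqnn k)) /=] := near_infty_natSinv_lt (PosNum t2).
  rewrite -/(s k) => kt.
  have k0 : 0 < s k by rewrite invr_gt0 ltr0n.
  have cc : c mu - s k < c mu + s k by lra.
  have [q] := rat_in_itvoo cc; rewrite in_itv/= => /andP[q1 q2].
  have Cmu : C q k mu by rewrite /C/= in_itv/=; apply/andP; split; lra.
  exists k => //; exists q => //; split => //.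
  exists mu; first exact: prokhorov_refl_lt.
  move=> la mla; rewrite /C/= in_itv/= => /andP[l1 l2].
  apply: eG; apply: tS; first by apply: lt_trans mla _; lra.
  by rewrite ltr_distl; apply/andP; split; lra.
apply: bigcupT_measurable => k; apply: bigcupT_measurable_rat => q.
apply: measurableI.
  by rewrite -[X in measurable X]setTI; exact: mc.
apply: mopen_MX_measurable => nu [mu mn H].
have [e [e0 eb]] := prokhorov_ball_mopen mu (s k) nu mn.
by exists e; split=> // la /eb ?; exists mu.
Qed.

End prokhorov.

Lemma measurable_mass_open {R : realType} {T : pointedType} (d : T -> T -> R)
    (dM : is_metric d) (B : set T) : mopen d B ->
  measurable_fun setT ((fun mu => mass mu B) : MX d -> R).
Proof.
move=> oB; have mB : measurable (B : set (borel_of d)) by exact: mopen_measurable.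
rewrite (_ : (fun mu => _) = fun mu : MX d =>
    1 - mass (mu : probability (borel_of d) R) (~` B)); last first.
  by apply/funext => mu; rewrite massC//; lra.
apply: measurable_funB => //; apply: measurable_mass_closed => //.
by rewrite setCK.
Qed.

(** * Sweeping the mass of an open set to a point outside it *)

Section sweep.
Context {R : realType} {T : pointedType} (d : T -> T -> R).
Hypothesis dM : is_metric d.
Variables (B : set T) (z : T).
Hypotheses (oB : mopen d B) (nBz : ~ B z).
Local Notation prob := (probability (borel_of d) R).
Implicit Types mu nu : prob.

Definition sweep_point (x : borel_of d) : borel_of d :=
  if pselect (B x) then z else x.

Let mB : measurable (B : set (borel_of d)).
Proof. exact: mopen_measurable. Qed.

Let mF : measurable (~` B : set (borel_of d)).
Proof. exact: measurableC. Qed.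

Lemma preimage_sweep_in (A : set T) : A z ->
  sweep_point @^-1` A = (A `&` ~` B) `|` B.
Proof.
move=> Az; apply/seteqP; split=> x; rewrite /sweep_point/=; case: pselect => Bx//.
- by right.
- by left.
- by case=> // -[].
Qed.

Lemma preimage_sweep_out (A : set T) : ~ A z ->
  sweep_point @^-1` A = A `&` ~` B.
Proof.
move=> Az; apply/seteqP; split=> x; rewrite /sweep_point/=; case: pselect => Bx//.
- by case.
- by case.
Qed.

Lemma measurable_sweep_point : measurable_fun setT sweep_point.
Proof.
move=> _ A mA; rewrite setTI; have [Az|nAz] := pselect (A z).
  by rewrite preimage_sweep_in//; apply: measurableU => //; exact: measurableI.
by rewrite preimage_sweep_out//; exact: measurableI.
Qed.

Definition sweep (mu : prob) : prob := pushprob measurable_sweep_point mu.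

Lemma mass_sweep mu A : mass (sweep mu) A = mass mu (sweep_point @^-1` A).
Proof. by []. Qed.

Lemma sweep_in mu (A : set (borel_of d)) : measurable A -> A z ->
  mass (sweep mu) A = mass mu (A `&` ~` B) + mass mu B.
Proof.
move=> mA Az; rewrite mass_sweep preimage_sweep_in//.
rewrite -massU//; first exact: measurableI.
by rewrite -setIA setICl setI0.
Qed.

Lemma sweep_out mu (A : set (borel_of d)) : ~ A z ->
  mass (sweep mu) A = mass mu (A `&` ~` B).
Proof. by move=> nAz; rewrite mass_sweep preimage_sweep_out. Qed.

Lemma sweep0 mu : mass (sweep mu) B = 0.
Proof. by rewrite sweep_out// setICr /mass measure0. Qed.

Lemma le_sweep mu (A : set (borel_of d)) : measurable A ->
  mass mu (A `&` ~` B) <= mass (sweep mu) A.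
Proof.
move=> mA; have [Az|nAz] := pselect (A z); last by rewrite sweep_out.
by rewrite sweep_in//; have := mass_ge0 mu B; lra.
Qed.

(** Only the mass in [B] moves, so [mu A] exceeds the swept mass of any enlargement of [A] by at
    most [mu B]. *)
Lemma prokhorov_sweep_lt mu (a : R) : 0 < a -> mass mu B < a ->
  prokhorov d mu (sweep mu) < a.
Proof.
move=> a0 Ba; have B0 := mass_ge0 mu B.
(* The midpoint is positive even when [B] is null, and strictly below [a]. *)
apply: (prokhorov_lt d dM _ _ ((mass mu B + a) / 2)); try lra.
set e := _ / 2; move=> A mA; have mE := enbhd_measurable d dM A e.
have e0 : 0 < e by rewrite /e; lra.
have := mass_le_setI_setC mu A (~` B) mA mF; rewrite setCK.
have : mass mu (A `&` ~` B) <= mass mu (enbhd d A e `&` ~` B).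
  apply: le_mass; [exact: measurableI..|].
  by apply: setSI; exact: enbhd_sub.
have := le_sweep mu _ mE; rewrite /e; lra.
Qed.

(** A small enlargement of [A] minus [B] can enter [B] only in a thin layer along the complement of
    [B], and that layer has small [mu]-mass. The atom created at [z] is controlled by the assumption
    on the masses of [B]. *)
Lemma sweep_continuous_modulo mu (e : R) : 0 < e ->
  exists2 t : R, 0 < t & forall nu, prokhorov d mu nu < t ->
    `|mass nu B - mass mu B| < t -> prokhorov d (sweep mu) (sweep nu) < e.
Proof.
move=> e0; have e4 : mass mu (~` B) < mass mu (~` B) + e / 4 by lra.
have oF : mopen d (~` ~` B) by rewrite setCK.
have [f f0 Ff] := mass_enbhd_lt d dM mu _ _ oF e4.
have mFf := enbhd_measurable d dM (~` B) f.
have mFB : measurable (enbhd d (~` B) f `&` B : set (borel_of d)).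
  exact: measurableI.
have FB : mass mu (enbhd d (~` B) f `&` B) < e / 4.
  move: Ff; rewrite (_ : enbhd d (~` B) f = ~` B `|` (enbhd d (~` B) f `&` B)).
    rewrite massU//; last by rewrite setIC -setIA setICr setI0.
    rewrite setIUl setICl set0U -setIA setIid; lra.
  rewrite setUIr setUCl setIT; apply/esym/setUidr.
  exact: enbhd_sub.
(* The bound [f] confines the spill to the layer, of mass below [e / 4]. The bound [e / 8] is spent
   twice, on the Prokhorov error and on the change of mass of [B], for a total of [e / 2]. *)
exists (Num.min f (e / 8)); first by rewrite lt_min f0/=; lra.
set t := Num.min f (e / 8) => nu mn; rewrite ltr_distl => /andP[B1 B2].
have tf : t <= f by rewrite /t ge_min lexx.
have te : t <= e / 8 by rewrite /t ge_min lexx orbT.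
have nm := prokhorov_close_sym d dM _ _ _ (prokhorov_lt_close d dM _ _ _ mn).
apply: (prokhorov_lt d dM _ _ (e / 2)); try lra.
(* Symmetry puts [mu] on the side of the enlargement, where the layer chosen for [mu] serves every
   [nu]. *)
apply: prokhorov_close_sym => // A mA.
have mE := enbhd_measurable d dM A (e / 2).
have mAF : measurable (A `&` ~` B) by exact: measurableI.
have step : mass nu (A `&` ~` B) <=
    mass mu (enbhd d A (e / 2) `&` ~` B) + e / 4 + t.
  have := nm _ mAF.
  have : mass mu (enbhd d (A `&` ~` B) t) <=
      mass mu ((enbhd d A (e / 2) `&` ~` B) `|` (enbhd d (~` B) f `&` B)).
    apply: le_mass; first exact: enbhd_measurable.
      by apply: measurableU => //; exact: measurableI.
    move=> x [y [[Ay nBy] xy]]; have [Bx|nBx] := pselect (B x).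
      by right; split=> //; exists y; split=> //; exact: lt_le_trans tf.
    by left; split=> //; exists y; split=> //; lra.
  rewrite massU//; first lra; first exact: measurableI.
  by rewrite setIACA setICl setI0.
have [Az|nAz] := pselect (A z).
  rewrite !sweep_in//; last by apply: enbhd_sub => //; lra.
  lra.
rewrite (sweep_out nu)//.
have := le_sweep mu _ mE; lra.
Qed.

Lemma measurable_sweep : measurable_fun setT (sweep : MX d -> MX d).
Proof.
apply: (measurable_continuous_modulo d dM _ (fun mu => mass mu B)).
  exact: measurable_mass_open.
exact: sweep_continuous_modulo.
Qed.

End sweep.

(** * The likelihood and the posterior quotient *)

Section likelihood.
Context {R : realType} {X : pointedType} (d : X -> X -> R).
Hypothesis dM : is_metric d.
Context {n : nat} (xs : 'I_n -> X) (delta : R).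
Local Notation lik := (likelihood d xs delta).

Lemma likelihood_ge0 mu : 0 <= lik mu.
Proof. by apply: prodr_ge0 => i _; exact: mass_ge0. Qed.

Lemma likelihood_le1 mu : lik mu <= 1.
Proof.
apply: prodr_ile1 => i _; apply/andP; split; first exact: mass_ge0.
by apply: mass_le1; exact: mball_measurable.
Qed.

Lemma measurable_likelihood : measurable_fun setT lik.
Proof.
apply: measurable_prod => i _.
by apply: measurable_mass_open => //; exact: mball_mopen.
Qed.

Lemma likelihood_eq0 (mu : probability (borel_of d) R) i :
  mass mu (mball d (xs i) delta) = 0 -> lik mu = 0.
Proof. by move=> mu0; apply/eqP/prodf_eq0; exists i => //; apply/eqP. Qed.

(** The likelihood lies between [0] and [1]. Finiteness makes the [fine] in [post_val] faithful. *)
Lemma post_den_fin (pi : probability (MX d) R) :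
  post_den d xs delta pi \is a fin_num.
Proof.
apply/fin_numPlt; apply/andP; split.
  by apply: (@lt_le_trans _ _ 0%E) => //; apply: integral_ge0 => mu _;
    rewrite lee_fin likelihood_ge0.
apply: (@le_lt_trans _ _ (\int[pi]_mu (cst 1 mu))%E).
  apply: ge0_le_integral => //.
  - by move=> mu _; rewrite lee_fin likelihood_ge0.
  - by apply/measurable_EFinP; exact: measurable_likelihood.
  - by move=> mu _; rewrite lee_fin likelihood_le1.
rewrite integral_cst// mul1e.
by apply: le_lt_trans (probability_le1 pi measurableT) _; rewrite ltry.
Qed.

Lemma post_val_ge (Phi : MX d -> R) (pi : probability (MX d) R) (r : R) :
  (0 < post_den d xs delta pi)%E ->
  (r%:E * post_den d xs delta pi <= post_num d xs delta Phi pi)%E ->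
  (r%:E <= post_val d xs delta Phi pi)%E.
Proof.
move=> D0; have Df := post_den_fin pi.
rewrite /post_val -[in X in X -> _](fineK Df).
have f0 : 0 < fine (post_den d xs delta pi) by apply: fine_gt0; rewrite D0 ltey_eq Df.
by rewrite lee_pdivlMr.
Qed.

Lemma post_val_le (Phi : MX d -> R) (pi : probability (MX d) R) (r : R) :
  (0 < post_den d xs delta pi)%E ->
  (post_num d xs delta Phi pi <= r%:E * post_den d xs delta pi)%E ->
  (post_val d xs delta Phi pi <= r%:E)%E.
Proof.
move=> D0; have Df := post_den_fin pi.
rewrite /post_val -[in X in X -> _](fineK Df).
have f0 : 0 < fine (post_den d xs delta pi) by apply: fine_gt0; rewrite D0 ltey_eq Df.
by rewrite lee_pdivrMr.
Qed.

End likelihood.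

(** * Positive integrals and comparison of extended reals *)

(** A nonnegative function with zero integral vanishes almost everywhere, which positivity on the
    non-null set [D] excludes. *)
Lemma integral_gt0_on {dd : measure_display} {T : measurableType dd}
    {R : realType} (mu : probability T R) (h : T -> R) (D : set T) :
  measurable_fun setT h -> (forall x, 0 <= h x) -> measurable D ->
  (forall x, D x -> 0 < h x) -> mu D <> 0%E -> (0 < \int[mu]_x (h x)%:E)%E.
Proof.
move=> mh h0 mD hD muD; rewrite lt0e; apply/andP; split; last first.
  by apply: integral_ge0 => x _; rewrite lee_fin.
apply/eqP => int0; apply: muD.
have mEh : measurable_fun setT (fun x => (h x)%:E) by exact/measurable_EFinP.
have [+ _] := ae_eq_integral_abs mu measurableT mEh.
have -> : (\int[mu]_x `|(h x)%:E| = 0)%E.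
  by rewrite -int0; apply: eq_integral => x _; rewrite gee0_abs// lee_fin.
move=> /(_ erefl); case=> N [mN muN sN].
apply: (subset_measure0 (B := N)) => // x Dx; apply: sN => /= /(_ I) [hx].
by have := hD x Dx; rewrite hx ltxx.
Qed.

(** Lets a possibly infinite essential supremum be handled through real thresholds only. *)
Lemma le_ereal_from_below {R : realType} (x y : \bar R) :
  (forall r : R, (r%:E < x)%E -> (r%:E <= y)%E) -> (x <= y)%E.
Proof.
move=> h; rewrite leNgt; apply/negP; move: x y h => [x| |] [y| |] h //=.
- rewrite lte_fin => yx; have := h ((x + y) / 2).
  rewrite lte_fin lee_fin => xy; suff : (x + y) / 2 <= y by lra.
  by apply: xy; lra.
- by move=> _; have /h : ((x - 1)%:E < x%:E)%E by rewrite lte_fin; lra.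
- by move=> _; have := h (y + 1) (ltry _); rewrite lee_fin; lra.
- by move=> _; have := h 0 (ltry _); rewrite leeNy_eq.
Qed.

Lemma le_ereal_from_above {R : realType} (x y : \bar R) :
  (forall r : R, (y < r%:E)%E -> (x <= r%:E)%E) -> (x <= y)%E.
Proof.
move=> h; rewrite -leeN2; apply: le_ereal_from_below => r.
by rewrite lteNr leeNr -EFinN; exact: h.
Qed.

(** * Construction of the perturbed prior *)

Section perturbed_priors.
Context {R : realType} {X Th : pointedType} (d : X -> X -> R) (dT : Th -> Th -> R)
  (P : Th -> probability (borel_of d) R) (PiTh : set (probability (borel_of dT) R))
  (delta alpha : R).
Hypotheses (dM : is_metric d)
  (mP : measurable_fun setT (P : borel_of dT -> MX d))
  (P_gt0 : forall th x e, 0 < e -> (0 < P th (mball d x e))%E)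
  (delta0 : 0 < delta) (alpha0 : 0 < alpha) (alpha1 : alpha < 1)
  (P_lt : (P_infty d P delta < alpha%:E)%E).

Lemma mass_ball_lt th x : mass (P th) (mball d x delta) < alpha.
Proof.
rewrite -lte_fin massK; last exact: mball_measurable.
by apply: le_lt_trans P_lt; apply: ereal_sup_ubound; exists x, th.
Qed.

(* Outside [E] the data-generating measure is replaced by one that does not
   charge the first data ball, so the posterior only sees parameters in [E]. *)
Lemma prior_concentrating_posterior {n : nat} (xs : 'I_n -> X)
    (pt : probability (borel_of dT) R) (E : set (MX d)) :
  (0 < n)%N -> PiTh pt -> measurable E ->
  pt ((P : borel_of dT -> MX d) @^-1` E) <> 0%E ->
  exists S : borel_of dT -> MX d, exists mS : measurable_fun setT S,
    [/\ Pialpha d dT P PiTh alpha (pushprob mS pt),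
        (0 < post_den d xs delta (pushprob mS pt))%E
      & forall th, E (S th) \/ likelihood d xs delta (S th) = 0].
Proof.
move=> n0 Ppt mE ptE.
pose P' : borel_of dT -> MX d := P.
have mPE : measurable (P' @^-1` E) by rewrite -[P' @^-1` E]setTI; exact: mP.
pose B := mball d (xs (Ordinal n0)) delta.
have oB : mopen d B by exact: mball_mopen.
(* Were the ball the whole space, any model measure, here the one at [point], would give it mass
   [1 > alpha]. *)
have [z nBz] : exists z, ~ B z.
  apply: contrapT => /forallNP nB.
  have BT : B = setT by apply/seteqP; split=> // x _; apply: contrapT; exact: nB.
  have := mass_ball_lt point (xs (Ordinal n0)).
  by rewrite -/B BT /mass probability_setT/= => /(lt_trans alpha1); rewrite ltxx.
pose S (th : borel_of dT) : MX d :=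
  if P' th \in E then P th else sweep d B z oB (P th).
have mS : measurable_fun setT S.
  apply: measurable_fun_ifT => //; last first.
    by apply: measurableT_comp mP; exact: measurable_sweep.
  apply: (measurable_fun_bool true).
  rewrite (_ : _ @^-1` _ = P' @^-1` E); last first.
    by apply/seteqP; split=> th /=; [move/set_mem|move/mem_set].
  exact: measurableI.
have SA th : calA d P alpha (P th, S th).
  split; first by exists th.
  rewrite /S /=; case: ifP => _; first exact: prokhorov_refl_lt.
  by apply: prokhorov_sweep_lt => //; exact: mass_ball_lt.
(* The law of [(P th, S th)] under [pt] is the required coupling: its marginals are the original and
   the perturbed prior, and every value of the pair lies in [calA]. *)
have mPS := measurable_fun_pair mP mS.
exists S, mS; split.
- exists (pushprob mPS pt); split.
  + move=> A mA A0; rewrite pushprobE /pushforward.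
    rewrite (_ : _ @^-1` A = set0) ?measure0//.
    apply/seteqP; split=> // th /= Ath.
    by have : (A `&` calA d P alpha) (P th, S th) by []; rewrite A0.
  + by exists (pushprob mP pt); split=> //; exists pt.
  + by [].
- rewrite /post_den pushprobE measurable_integral_pushforward//; last first.
    by apply/measurable_EFinP; exact: measurable_likelihood.
  apply: (integral_gt0_on pt (fun th => likelihood d xs delta (S th)) (P' @^-1` E)) => //.
  + by apply: measurableT_comp mS; exact: measurable_likelihood.
  + by move=> th; exact: likelihood_ge0.
  (* Over [E] nothing is perturbed, so positivity of the model makes every factor of the likelihood
     positive. *)
  + move=> th /= Eth; rewrite /S mem_set//; apply: prodr_gt0 => i _.
    rewrite -lte_fin -/(mass _ _) massK; last exact: mball_measurable.
    exact: P_gt0.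
- move=> th; rewrite /S; case: ifPn => [|_]; first by rewrite inE; left.
  by right; apply: (likelihood_eq0 _ _ _ _ (Ordinal n0)); exact: sweep0.
Qed.

End perturbed_priors.

(** * From pointwise comparison to the two posterior bounds *)

(** The integrands are compared only on the range of [f], which is all that is known of the
    perturbed measures [S th]; pulling back to the source suffices. *)
Lemma le_integral_pushprob {d1 d2 : measure_display} {T1 : measurableType d1}
    {T2 : measurableType d2} {R : realType} {f : T1 -> T2}
    (mf : measurable_fun setT f) (mu : probability T1 R) (g h : T2 -> R) :
  measurable_fun setT g -> measurable_fun setT h ->
  (forall x, g (f x) <= h (f x)) ->
  (\int[pushprob mf mu]_y (g y)%:E <= \int[pushprob mf mu]_y (h y)%:E)%E.
Proof.
move=> mg mh gh.
have mEg : measurable_fun setT (fun y => (g y)%:E) by exact/measurable_EFinP.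
have mEh : measurable_fun setT (fun y => (h y)%:E) by exact/measurable_EFinP.
rewrite pushprobE (measurable_integral_pushforward f mf mu _ mEg).
rewrite (measurable_integral_pushforward f mf mu _ mEh).
apply: measurable_le_integral => [||x]; last by rewrite lee_fin.
  by apply/measurable_EFinP; exact: measurableT_comp mf.
by apply/measurable_EFinP; exact: measurableT_comp mf.
Qed.

Lemma post_denZ {R : realType} {X : pointedType} (d : X -> X -> R)
    (dM : is_metric d) {n : nat} (xs : 'I_n -> X) (delta : R)
    (pi : probability (MX d) R) (r : R) :
  (r%:E * post_den d xs delta pi =
   \int[pi]_mu (r * likelihood d xs delta mu)%:E)%E.
Proof.
rewrite /post_den -integralZl//; apply/integrableP; split.
  by apply/measurable_EFinP; exact: measurable_likelihood.
rewrite [ltLHS](_ : _ = post_den d xs delta pi).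
  by rewrite ltey_eq post_den_fin.
by apply: eq_integral => mu _; rewrite gee0_abs// lee_fin likelihood_ge0.
Qed.

Theorem theorem6p9 (R : realType) (X Th : pointedType)
    (d : X -> X -> R) (dT : Th -> Th -> R)
    (P : Th -> probability (borel_of d) R)
    (PiTh : set (probability (borel_of dT) R))
    (Phi0 : MX d -> R) (delta alpha : R) :
  polish_metric d -> polish_metric dT ->
  measurable_fun setT (P : borel_of dT -> MX d) ->
  (forall th x e, 0 < e -> (0 < P th (mball d x e))%E) ->
  measurable_fun setT Phi0 -> semibounded Phi0 ->
  0 < delta -> 0 < alpha -> alpha < 1 ->
  (P_infty d P delta < alpha%:E)%E ->
  forall (n : nat) (xs : 'I_n -> X), (1 <= n)%N ->
    (ess_sup_over d (Pi0 d dT P PiTh) Phi0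
       <= post_U d xs delta Phi0 (Pialpha d dT P PiTh alpha))%E /\
    (post_L d xs delta Phi0 (Pialpha d dT P PiTh alpha)
       <= ess_inf_over d (Pi0 d dT P PiTh) Phi0)%E.
Proof.
move=> [dM _ _] _ mP P_gt0 mPhi _ delta0 alpha0 alpha1 P_lt n xs n0.
have mlik := measurable_likelihood d dM xs delta.
have mlikZ r : measurable_fun setT (fun mu => r * likelihood d xs delta mu).
  exact: measurable_funM.
have mnum : measurable_fun setT (fun mu => Phi0 mu * likelihood d xs delta mu).
  exact: measurable_funM.
split.
- apply: ge_ereal_sup => _ [nu [pt [Ppt nuE]] <-].
  apply: le_ereal_from_below => r rlt.
  pose E : set (MX d) := [set mu | r < Phi0 mu].
  have mE : measurable E.
    rewrite (_ : E = setT `&` Phi0 @^-1` `]r, +oo[); first exact: mPhi.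
    by apply/seteqP; split=> mu; rewrite /E/= in_itv/= andbT// => -[].
  (* Otherwise [r] would belong to the set whose infimum is the essential supremum, contradicting
     [rlt]. *)
  have ptE : pt ((P : borel_of dT -> MX d) @^-1` E) <> 0%E.
    rewrite -nuE// => nu0; move: rlt; apply/negP; rewrite -leNgt.
    by apply: ereal_inf_lbound; exists r.
  have [S [mS [PiS den0 SE]]] := prior_concentrating_posterior d dT P PiTh
    delta alpha dM mP P_gt0 delta0 alpha0 alpha1 P_lt xs pt E n0 Ppt mE ptE.
  apply: (@le_trans _ _ (post_val d xs delta Phi0 (pushprob mS pt))).
    apply: post_val_ge => //; rewrite post_denZ//.
    apply: le_integral_pushprob => // th.
    (* Either [Phi0] exceeds [r] at [S th], or the likelihood vanishes and both integrands are
       [0]. *)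
    case: (SE th) => [/ltW rPhi|->]; last by rewrite !mulr0.
    by rewrite ler_wpM2r// likelihood_ge0.
  by apply: ereal_sup_ubound; exists (pushprob mS pt).
(* The same construction with [E] the set where [Phi0 < r] and all inequalities reversed. *)
- apply: le_ereal_inf_tmp => _ [nu [pt [Ppt nuE]] <-].
  apply: le_ereal_from_above => r rlt.
  pose E : set (MX d) := [set mu | Phi0 mu < r].
  have mE : measurable E.
    rewrite (_ : E = setT `&` Phi0 @^-1` `]-oo, r[); first exact: mPhi.
    by apply/seteqP; split=> mu; rewrite /E/= in_itv/=// => -[].
  have ptE : pt ((P : borel_of dT -> MX d) @^-1` E) <> 0%E.
    rewrite -nuE// => nu0; move: rlt; apply/negP; rewrite -leNgt.
    by apply: ereal_sup_ubound; exists r.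
  have [S [mS [PiS den0 SE]]] := prior_concentrating_posterior d dT P PiTh
    delta alpha dM mP P_gt0 delta0 alpha0 alpha1 P_lt xs pt E n0 Ppt mE ptE.
  apply: (@le_trans _ _ (post_val d xs delta Phi0 (pushprob mS pt))).
    by apply: ereal_inf_lbound; exists (pushprob mS pt).
  apply: post_val_le => //; rewrite post_denZ//.
  apply: le_integral_pushprob => // th.
  case: (SE th) => [/ltW Phir|->]; last by rewrite !mulr0.
  by rewrite ler_wpM2r// likelihood_ge0.
Qed.
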